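(* Let $1\leq p\leq q\leq\infty$, and let $\{E_i\}_{i\in I}$ be a non-empty family of locally convex spaces. Then: (i) a subset $K$ of $E=\prod_{i\in I} E_i$ is a $(p,q)$-limited (resp., $(p,q)$-$\mathcal{E}$-limited) set if and only if so are all its coordinate projections; (ii) a subset $K$ of $E=\bigoplus_{i\in I} E_i$ is a $(p,q)$-limited (resp., $(p,q)$-$\mathcal{E}$-limited) set if and only if so are all its coordinate projections and the support of $K$ is finite.
   Context: All locally convex spaces are Hausdorff, over $\mathbb{F}\in\{\mathbb{R},\mathbb{C}\}$; $\omega=\{0,1,2,\dots\}$. $\prod_{i\in I}E_i$ carries the product topology and $\bigoplus_{i\in I}E_i$ is the locally convex direct sum. For $x=(x_i)\in\bigoplus_{i\in I}E_i$, $\mathrm{supp}(x)=\{i\in I:x_i\neq0\}$, and the support of a subset $K$ is $\bigcup_{x\in K}\mathrm{supp}(x)$. The coordinate projections of $K$ are the images $K_i\subseteq E_i$ of $K$ under the canonical projections $E\to E_i$. For an lcs $E$ with topological dual $E'$, $A\subseteq E$ and $\chi\in E'$, put $\|\chi\|_A:=\sup\{|\chi(x)|:x\in A\cup\{0\}\}$. A sequence $\{\chi_n\}_{n\in\omega}$ in $E'$ is weak$^\ast$ $p$-summable if $(\langle\chi_n,x\rangle)_n\in\ell_p$ (or $\in c_0$ if $p=\infty$) for every $x\in E$. A non-empty subset $A$ of $E$ is $(p,q)$-limited (resp., $(p,q)$-$\mathcal{E}$-limited) if $(\|\chi_n\|_A)_n\in\ell_q$ if $q<\infty$, or $\|\chi_n\|_A\to0$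 if $q=\infty$, for every (resp., every equicontinuous) weak$^\ast$ $p$-summable sequence $\{\chi_n\}$ in $E'$. *)

(* Defs.v *)
From HB Require Import structures.
From mathcomp Require Import all_boot all_order all_algebra.
From mathcomp Require Import all_classical all_reals all_analysis.
From mathcomp Require Import complex.

Set Implicit Arguments.
Unset Strict Implicit.
Unset Printing Implicit Defensive.

Import Order.TTheory GRing.Theory Num.Theory.
Import numFieldNormedType.Exports.

Local Open Scope classical_set_scope.
Local Open Scope ring_scope.

Section ProdNmodule.
Variables (I : Type) (E : I -> nmodType).
Implicit Types x y z : prod_topology E.

Let prod_add x y : prod_topology E := fun i => x i + y i.
Let prod_zero : prod_topology E := fun i => 0.

Let prod_addA : associative prod_add.
Proof. by move=> x y z; apply: functional_extensionality_dep => i; exact: addrA. Qed.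
Let prod_addC : commutative prod_add.
Proof. by move=> x y; apply: functional_extensionality_dep => i; exact: addrC. Qed.
Let prod_add0 : left_id prod_zero prod_add.
Proof. by move=> x; apply: functional_extensionality_dep => i; exact: add0r. Qed.

HB.instance Definition _ :=
  @GRing.isNmodule.Build (prod_topology E) prod_zero prod_add
    prod_addA prod_addC prod_add0.
End ProdNmodule.

Section ProdZmodule.
Variables (I : Type) (E : I -> zmodType).

Let prod_opp (x : prod_topology E) : prod_topology E := fun i => - x i.

Let prod_addN : left_inverse (0 : prod_topology E) prod_opp +%R.
Proof. by move=> x; apply: functional_extensionality_dep => i; exact: addNr. Qed.

HB.instance Definition _ :=
  @GRing.Nmodule_isZmodule.Build (prod_topology E) prod_opp prod_addN.
End ProdZmodule.

Section ProdLmodule.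
Variables (K : pzRingType) (I : Type) (E : I -> lmodType K).
Implicit Types x y : prod_topology E.

Let prod_scale (a : K) x : prod_topology E := fun i => a *: x i.

Let prod_scaleA a b x : prod_scale a (prod_scale b x) = prod_scale (a * b) x.
Proof. by apply: functional_extensionality_dep => i; exact: scalerA. Qed.
Let prod_scale1 : left_id 1 prod_scale.
Proof. by move=> x; apply: functional_extensionality_dep => i; exact: scale1r. Qed.
Let prod_scaleDr : right_distributive prod_scale +%R.
Proof. by move=> a x y; apply: functional_extensionality_dep => i; exact: scalerDr. Qed.
Let prod_scaleDl x : {morph prod_scale^~ x : a b / a + b}.
Proof. by move=> a b; apply: functional_extensionality_dep => i; exact: scalerDl. Qed.

HB.instance Definition _ :=
  @GRing.Zmodule_isLmodule.Build K (prod_topology E) prod_scale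
    prod_scaleA prod_scale1 prod_scaleDr prod_scaleDl.
End ProdLmodule.

Section ProdTvs.
Variables (K : numFieldType) (I : Type) (E : I -> tvsType K).
Notation P := (prod_topology E).

Lemma prod_proj_continuous i : continuous (fun x : P => x i).
Proof. exact: (@proj_continuous {classic I} E i). Qed.

Lemma prod_cvgP (F : set_system P) (t : P) : Filter F ->
  F --> t <-> forall i, (fun x : P => x i) @ F --> t i.
Proof.
move=> FF; split => [Ft i|Ft].
  apply: cvg_trans; last exact: (@prod_proj_continuous i t).
  exact: cvg_app Ft.
apply/cvg_sup => i A [_ [[B Bo <-] Bt BA]].
apply: (filterS BA); apply: Ft; exact: open_nbhs_nbhs.
Qed.

Let prod_add_continuous : continuous (fun x : P * P => x.1 + x.2).
Proof.
move=> [x y]; apply/prod_cvgP => i.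
have p1 : (fun z : P * P => z.1 i) @ (x, y) --> x i.
  apply: (@continuous_comp (P * P)%type P (E i) fst (fun u : P => u i) (x, y)).
    exact: cvg_fst.
  exact: prod_proj_continuous.
have p2 : (fun z : P * P => z.2 i) @ (x, y) --> y i.
  apply: (@continuous_comp (P * P)%type P (E i) snd (fun u : P => u i) (x, y)).
    exact: cvg_snd.
  exact: prod_proj_continuous.
have xyi : (fun z : P * P => (z.1 i, z.2 i)) @ (x, y) --> (x i, y i).
  exact: cvg_pair p1 p2.
exact: (cvg_comp _ _ xyi (@add_continuous (E i) (x i, y i))).
Qed.

Let prod_scale_continuous : continuous (fun z : K^o * P => z.1 *: z.2).
Proof.
move=> [a x]; apply/prod_cvgP => i.
have p1 : (fun z : K^o * P => z.1) @ (a, x) --> (a : K^o) by exact: cvg_fst.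
have p2 : (fun z : K^o * P => z.2 i) @ (a, x) --> x i.
  apply: (@continuous_comp (K^o * P)%type P (E i) snd (fun u : P => u i) (a, x)).
    exact: cvg_snd.
  exact: prod_proj_continuous.
have axi : (fun z : K^o * P => (z.1, z.2 i)) @ (a, x) --> (a : K^o, x i).
  exact: cvg_pair p1 p2.
exact: (cvg_comp _ _ axi (@scale_continuous K (E i) (a, x i))).
Qed.

Let prod_locally_convex :
  exists2 B : set_system P, (forall b, b \in B -> convex_set b) & basis B.
Proof.
pose B := [set b : set P | open b /\ convex_set b].
exists B; first by move=> b /set_mem[].
split; first by move=> b [].
move=> x; pose F := filter_from [set U | B U /\ U x] id.
have FF : Filter F.
  apply: filter_from_filter.
    exists setT; split => //; split; first exact: openT.
    by move=> *; exact: mem_set.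
  move=> U V [[oU cU] Ux] [[oV cV] Vx]; exists (U `&` V) => //.
  split => //; split; first exact: openI.
  move=> y z l /set_mem[Uy Vy] /set_mem[Uz Vz]; apply/mem_set; split.
    by apply/set_mem/cU; exact: mem_set.
  by apply/set_mem/cV; exact: mem_set.
apply/prod_cvgP => i A Ai.
have [Bi cBi [oBi /(_ (x i) A Ai) [C [BC Cx] CA]]] := @locally_convex K (E i).
exists ((fun y : P => y i) @^-1` C); last by move=> y /= /CA.
split => //; split.
  apply: open_comp; last exact: oBi.
  by move=> y _; exact: prod_proj_continuous.
move=> y z l /set_mem yC /set_mem zC; apply/mem_set.
by apply/set_mem/(cBi C (mem_set BC)); exact: mem_set.
Qed.

HB.instance Definition _ :=
  PreTopologicalNmodule_isTopologicalNmodule.Build P prod_add_continuous.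
HB.instance Definition _ :=
  TopologicalNmodule_isTopologicalLmodule.Build K P prod_scale_continuous.
HB.instance Definition _ := Uniform_isTvs.Build K P prod_locally_convex.

End ProdTvs.

Definition absolutely_convex (K : numFieldType) (M : lmodType K) (V : set M) :=
  V 0 /\ forall (a b : K) x y, `|a| + `|b| <= 1 ->
    V x -> V y -> V (a *: x + b *: y).

Lemma balanced (K : numFieldType) (M : lmodType K) (V : set M) (c : K) x :
  absolutely_convex V -> `|c| <= 1 -> V x -> V (c *: x).
Proof.
move=> [V0 cV] c1 Vx; rewrite -[_ *: _]addr0 -(scaler0 M 0).
by apply: cV => //; rewrite normr0 addr0.
Qed.

Section DirectSumLmodule.
Variables (K : numFieldType) (I : Type) (E : I -> lmodType K).
Notation P := (prod_topology E).

Definition supp (x : P) : set I := [set i | x i != 0].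

Definition finsupp_pred : {pred P} := fun x => `[< finite_set (supp x) >].

Let finsupp_submod_closed : submod_closed finsupp_pred.
Proof.
split=> [|a x y /asboolP fx /asboolP fy]; apply/asboolP.
  rewrite (_ : supp 0 = set0) //; apply/seteqP; split => // i /=.
  by rewrite /supp /= eqxx.
apply: (@sub_finite_set _ _ (supp x `|` supp y)); last by rewrite finite_setU.
move=> i; have [xi0|] := eqVneq (x i) 0; last by left.
have [yi0|] := eqVneq (y i) 0; last by right.
rewrite /supp /= (_ : (a *: x + y) i = a *: x i + y i) //.
by rewrite xi0 yi0 scaler0 addr0 eqxx.
Qed.

HB.instance Definition _ :=
  GRing.isSubmodClosed.Build K P finsupp_pred finsupp_submod_closed.

Record direct_sum := DirectSum {
  direct_sum_val :> P;
  _ : direct_sum_val \in finsupp_pred }.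

HB.instance Definition _ := [isSub for direct_sum_val].
HB.instance Definition _ := [Choice of direct_sum by <:].
HB.instance Definition _ := [SubChoice_isSubLmodule of direct_sum by <:].

Lemma finite_supp (x : direct_sum) : finite_set (supp x).
Proof. by case: x => x /= /asboolP. Qed.

Let inj_finsupp i (e : E i) :
  (@dfwith {classic I} E (fun=> 0) i e : P) \in finsupp_pred.
Proof.
apply/asboolP; apply: (@sub_finite_set _ _ [set i]) => // j /=.
have [ji|ij] := eqVneq (i : {classic I}) j; first by move=> _ /=; rewrite ji.
by rewrite /supp /= dfwithout ?eqxx.
Qed.

Definition direct_sum_inj i (e : E i) : direct_sum := DirectSum (inj_finsupp e).

Lemma direct_sum_injZ i a (e : E i) :
  direct_sum_inj (a *: e) = a *: direct_sum_inj e.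
Proof.
apply: val_inj; apply: functional_extensionality_dep => j.
change (@dfwith {classic I} E (fun=> 0) i (a *: e) j =
  a *: (@dfwith {classic I} E (fun=> 0) i e j)).
case: (@dfwithP {classic I} E (fun=> 0) i (a *: e) j) => [|k ik].
  by rewrite dfwithin.
by rewrite dfwithout // scaler0.
Qed.

Lemma direct_sum_absorb (V : set direct_sum) (x : direct_sum) :
  absolutely_convex V ->
  (forall i (e : E i), exists2 t : K, 0 < t & V (t *: direct_sum_inj e)) ->
  exists2 t : K, 0 < t & V (t *: x).
Proof.
move=> [V0 cV] aV.
have [s sx] : exists s : seq {classic I}, supp x `<=` [set` s].
  have /(@finite_seqP {classic I})[s sE] := finite_supp x.
  by exists s; rewrite -sE.
elim: s x sx => [|i s IH] x sx.
  exists 1 => //; rewrite scale1r (_ : x = 0) //.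
  apply: val_inj; apply: functional_extensionality_dep => j.
  by apply/eqP; apply: contraT => /sx.
pose x' := x - direct_sum_inj (direct_sum_val x i).
have x'E j : direct_sum_val x' j = direct_sum_val x j -
  @dfwith {classic I} E (fun=> 0) i (direct_sum_val x i) j by [].
have sx' : supp x' `<=` [set` s].
  move=> j; rewrite -[supp x' j]/(is_true (direct_sum_val x' j != 0)) x'E.
  case: (@dfwithP {classic I} E (fun=> 0) i (direct_sum_val x i) j) => [|k ik].
    by rewrite subrr eqxx.
  rewrite subr0 => /sx /=; rewrite inE => /orP[/eqP ki|//].
  by rewrite ki eqxx in ik.
have [u u0 Vu] := IH x' sx'.
have [v v0 Vv] := aV i (direct_sum_val x i).
have uv0 : 0 < u + v by rewrite addr_gt0.
exists (u * v / (u + v)); first by rewrite divr_gt0 ?mulr_gt0.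
rewrite (_ : _ *: x = (v / (u + v)) *: (u *: x') +
    (u / (u + v)) *: (v *: direct_sum_inj (direct_sum_val x i))).
  have a0 : 0 <= v / (u + v) by rewrite divr_ge0 // ltW.
  have b0 : 0 <= u / (u + v) by rewrite divr_ge0 // ltW.
  apply: cV => //; rewrite !ger0_norm // -mulrDl addrC divff ?lexx //.
  by rewrite gt_eqF.
rewrite !scalerA -[in LHS](subrK (direct_sum_inj (direct_sum_val x i)) x) scalerDr -/x'.
congr (_ *: _ + _ *: _); rewrite [RHS]mulrAC //.
by rewrite [v * u]mulrC.
Qed.

End DirectSumLmodule.
Arguments direct_sum_inj {K I E} i e.

Section DirectSumTvs.
Variables (K : numFieldType) (I : Type) (E : I -> tvsType K).
Notation S := (direct_sum E).

(* absolutely convex sets whose preimages under the inclusions are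
   neighborhoods of 0: the basis at 0 of the finest locally convex topology
   making every inclusion [E i -> S] continuous *)
Definition direct_sum_base (V : set S) :=
  absolutely_convex V /\ forall i, nbhs (0 : E i) (direct_sum_inj i @^-1` V).

Definition direct_sum_nbhs (x : S) : set_system S :=
  [set U | exists2 V, direct_sum_base V & forall v, V v -> U (x + v)].

Let base_scale (V : set S) (c : K) : c != 0 ->
  direct_sum_base V -> direct_sum_base [set v | V (c *: v)].
Proof.
move=> c0 [[V0 cV] nV]; split; first split.
- by rewrite /= scaler0.
- move=> a b x y ab Vx Vy /=.
  by rewrite scalerDr !scalerA ![c * _]mulrC -!scalerA; exact: cV.
- move=> i; have /= := @nbhs0Z K (E i) _ c^-1 _ (nV i).
  rewrite invr_eq0 => /(_ c0); apply: filterS => _ [e Ve <-] /=.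
  by rewrite direct_sum_injZ scalerA divff // scale1r.
Qed.

Let base_I (V W : set S) :
  direct_sum_base V -> direct_sum_base W -> direct_sum_base (V `&` W).
Proof.
move=> [[V0 cV] nV] [[W0 cW] nW].
split; last by move=> i; exact: filterI (nV i) (nW i).
split => // a b y z ab [Vy Wy] [Vz Wz].
by split; [exact: cV|exact: cW].
Qed.

Let half_sum (V : set S) (v w : S) : direct_sum_base V ->
  V (2 *: v) -> V (2 *: w) -> V (v + w).
Proof.
move=> [[_ cV] _] Vv Vw.
have -> : v + w = 2^-1 *: (2 *: v) + 2^-1 *: (2 *: w).
  by rewrite !scalerA mulVf ?pnatr_eq0 // !scale1r.
by apply: cV => //; rewrite !ger0_norm ?invr_ge0 // [leRHS]splitr !mul1r.
Qed.

Let nbhs_pfilter (x : S) : ProperFilter (direct_sum_nbhs x).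
Proof.
split.
  by move=> [V [[V0 _] _]] /(_ _ V0).
split.
- by exists setT => //; split => // i; exact: filterT.
- move=> A B [V bV VA] [W bW WB].
  by exists (V `&` W); [exact: base_I|move=> v [/VA ? /WB]].
- by move=> A B AB [V bV VA]; exists V => // v /VA/AB.
Qed.

Let nbhs_single (x : S) (A : set S) : direct_sum_nbhs x A -> A x.
Proof. by move=> [V [[V0 _] _]] /(_ _ V0); rewrite addr0. Qed.

Let nbhs_nbhs (x : S) (A : set S) :
  direct_sum_nbhs x A -> direct_sum_nbhs x (direct_sum_nbhs^~ A).
Proof.
move=> [V bV VA]; exists [set v | V (2 *: v)].
  by apply: base_scale => //; rewrite pnatr_eq0.
move=> v /= Vv; exists [set v | V (2 *: v)].
  by apply: base_scale => //; rewrite pnatr_eq0.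
by move=> w /= Vw; rewrite -addrA; apply: VA; exact: half_sum.
Qed.

HB.instance Definition _ := hasNbhs.Build S direct_sum_nbhs.
HB.instance Definition _ :=
  Nbhs_isNbhsTopological.Build S nbhs_pfilter nbhs_single nbhs_nbhs.

Let add_cts : continuous (fun z : S * S => z.1 + z.2).
Proof.
move=> [x y] A /= [V bV VA].
have b2 : direct_sum_base [set v | V (2 *: v)].
  by apply: base_scale => //; rewrite pnatr_eq0.
exists ([set x + v | v in [set v | V (2 *: v)]],
        [set y + v | v in [set v | V (2 *: v)]]) => /=.
  by split; exists [set v | V (2 *: v)] => // v Vv; exists v.
move=> [_ _] [/= [v Vv <-] [w Vw <-]] /=.
by rewrite addrACA; apply: VA; exact: half_sum.
Qed.

Let absorb (V : set S) (x : S) : direct_sum_base V ->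
  exists2 t : K, 0 < t & V (t *: x).
Proof.
move=> [cV nV]; apply: direct_sum_absorb => // i e.
have /= := @scale_continuous K (E i) (0, e) (direct_sum_inj i @^-1` V).
rewrite scale0r => /(_ (nV i)) [[/= A B] [/= [r r0 rA] Be] AB].
exists (r / 2); first by rewrite divr_gt0.
rewrite -direct_sum_injZ; apply: (AB (r / 2, e)); split => /=.
  apply: rA; rewrite /ball_ /= sub0r normrN ger0_norm ?divr_ge0 ?ltW //.
  by rewrite ltr_pdivrMr // ltr_pMr // ltr1n.
exact: nbhs_singleton.
Qed.

Let scale_cts : continuous (fun z : K^o * S => z.1 *: z.2).
Proof.
move=> [a x] A /= [V bV VA].
pose M : K := `|a| + 1.
have M0 : 0 < M by rewrite ltr_wpDl.
have b2 : direct_sum_base [set v | V (2 *: v)].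
  by apply: base_scale => //; rewrite pnatr_eq0.
have b2M : direct_sum_base [set v | V ((2 * M) *: v)].
  by apply: base_scale => //; rewrite mulf_neq0 ?pnatr_eq0 // gt_eqF.
have [t t0 Vt] := absorb x b2.
exists (ball (a : K^o) 1 `&` ball (a : K^o) t,
        [set x + v | v in [set v | V ((2 * M) *: v)]]) => /=.
  split; last by exists [set v | V ((2 * M) *: v)] => // v Vv; exists v.
  by apply: filterI; exact: nbhsx_ballx.
move=> [l _] [/= [l1 lt] [v Vv <-]].
have -> : l *: (x + v) = a *: x + ((l - a) *: x + l *: v).
  by rewrite scalerDr scalerBl [RHS]addrA subrKC.
apply: (VA); apply: half_sum => //.
  rewrite (_ : 2 *: _ = ((l - a) / t) *: (2 *: (t *: x))).
    apply: (balanced bV.1) => //.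
    by rewrite normrM normfV (ger0_norm (ltW t0)) ler_pdivrMr // mul1r
      distrC ltW.
  rewrite !scalerA; congr (_ *: _).
  by rewrite [2 * t]mulrC mulrA divfK ?gt_eqF // mulrC.
rewrite (_ : 2 *: _ = (l / M) *: ((2 * M) *: v)).
  apply: (balanced bV.1) => //.
  rewrite normrM normfV (ger0_norm (ltW M0)) ler_pdivrMr // mul1r.
  rewrite -[l](subKr a) (le_trans (ler_normB _ _)) // lerD2l.
  exact: ltW.
rewrite !scalerA; congr (_ *: _).
by rewrite [2 * M]mulrC mulrA divfK ?gt_eqF // mulrC.
Qed.

Let loc_convex :
  exists2 B : set_system S, (forall b, b \in B -> convex_set b) & basis B.
Proof.
exists [set b : set S | open b /\ convex_set b]; first by move=> b /set_mem[].
split; first by move=> b [].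
move=> x U [V bV VU].
pose W := [set x + v | v in V].
exists W°; last first.
  by move=> y /interior_subset [v /VU ? <-].
split; last by exists V => // v Vv; exists v.
split; first exact: open_interior.
move=> y z l /set_mem[Y bY YW] /set_mem[Z bZ ZW]; apply/mem_set.
exists (Y `&` Z); first exact: base_I.
move=> w [/YW[v Vv vE] /ZW[v' Vv' v'E]].
exists (l%:num *: v + (1 - l%:num) *: v').
  apply: bV.1.2 => //; rewrite !ger0_norm ?subr_ge0 //.
  by rewrite addrCA subrr addr0.
have cE (u : S) : l%:num *: u + (1 - l%:num) *: u = u.
  by rewrite -scalerDl subrKC scale1r.
change (x + (l%:num *: v + (1 - l%:num) *: v') =
  l%:num *: y + (1 - l%:num) *: z + w).
rewrite -[x in LHS]cE -[w in RHS]cE addrACA [RHS]addrACA.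
by rewrite -!scalerDr vE v'E.
Qed.

HB.instance Definition _ :=
  PreTopologicalLmod_isTvs.Build K S add_cts scale_cts loc_convex.
HB.instance Definition _ :=
  PreTopologicalNmodule_isTopologicalNmodule.Build S add_cts.
HB.instance Definition _ :=
  TopologicalNmodule_isTopologicalLmodule.Build K S scale_cts.
HB.instance Definition _ := Uniform_isTvs.Build K S loc_convex.

End DirectSumTvs.
Variant scalar_kind := RealScalars | ComplexScalars.

Definition scalars (R : realType) (k : scalar_kind) : numFieldType :=
  match k with RealScalars => R | ComplexScalars => R[i] end.

(* The norm [`|x|] of [x : R[i]] lives in [R[i]]; this modulus is real-valued. *)
Definition modulus (R : realType) (k : scalar_kind) : scalars R k -> R :=
  match k return scalars R k -> R with
  | RealScalars => fun x : R => `|x|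
  | ComplexScalars => fun x : R[i] => ComplexField.Normc.normc x
  end.

(* Membership of a sequence of nonnegative extended reals in [l_p] if [p] is
   finite, and in [c_0] if [p] is infinite. *)
Definition lp_c0 (R : realType) (p : \bar R) (u : nat -> \bar R) : Prop :=
  match p with
  | r%:E => (\sum_(0 <= n <oo) (u n `^ r) < +oo)%E
  | +oo%E => u @ \oo --> 0%E
  | -oo%E => False
  end.

Section Limited.
Variables (R : realType) (k : scalar_kind) (E : tvsType (scalars R k)).
Notation K := (scalars R k).

Record topdual := TopDual {
  dual_val :> {linear E -> K^o};
  dual_continuous : continuous dual_val }.

(* may be [+oo] when [chi] is unbounded on [A] *)
Definition dual_seminorm (A : set E) (chi : topdual) : \bar R :=
  ereal_sup [set (modulus (chi x))%:E | x in A `|` [set 0]].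

Definition weak_star_summable (p : \bar R) (chi : nat -> topdual) : Prop :=
  forall x, lp_c0 p (fun n => (modulus (chi n x))%:E).

Definition dual_equicontinuous (chi : nat -> topdual) : Prop :=
  equicontinuous [set: nat] (fun n => chi n : E -> K^o).

Definition limited (p q : \bar R) (A : set E) : Prop :=
  A !=set0 /\ forall chi : nat -> topdual, weak_star_summable p chi ->
    lp_c0 q (fun n => dual_seminorm A (chi n)).

Definition E_limited (p q : \bar R) (A : set E) : Prop :=
  A !=set0 /\ forall chi : nat -> topdual, dual_equicontinuous chi ->
    weak_star_summable p chi -> lp_c0 q (fun n => dual_seminorm A (chi n)).

End Limited.

Definition prod_coord (K : numFieldType) (I : Type) (E : I -> tvsType K) (i : I)
  (x : prod_topology E) : E i := x i.

Definition direct_sum_coord (K : numFieldType) (I : Type)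
  (E : I -> tvsType K) (i : I) (x : direct_sum E) : E i := direct_sum_val x i.

Definition set_supp (K : numFieldType) (I : Type) (E : I -> tvsType K)
  (A : set (direct_sum E)) : set I := \bigcup_(x in A) supp x.

(* Main.v *)
Require Import Defs.
From HB Require Import structures.
From mathcomp Require Import all_boot all_order all_algebra.
From mathcomp Require Import all_classical all_reals all_analysis.
From mathcomp Require Import complex ring lra.

Set Implicit Arguments.
Unset Strict Implicit.
Unset Printing Implicit Defensive.

Import Order.TTheory GRing.Theory Num.Theory.
Import numFieldNormedType.Exports.

Local Open Scope classical_set_scope.
Local Open Scope ring_scope.

(**
A functional on [E] restricts to each summand or factor [E i], and conversely
a functional on [E i] pulls back along the coordinate map [E -> E i].  Pulling
back preserves weak* p-summability and equicontinuity, and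
[‖chi \o f‖_A = ‖chi‖_(f A)], so limitedness passes to continuous linear
images ([limited_image]); in particular it passes to coordinate projections.

For the converse the key is a finite decomposition.  If every [chi n] of a
given sequence satisfies [chi n x = \sum_(j in s) chi n (inj j (x j))] on [A],
for one finite [s] independent of [n], then
[‖chi n‖_A <= \sum_(j in s) ‖chi n \o inj j‖_(A_j)], and each term on the right is
q-summable in [n] as [A_j] is limited ([limited_decomposition]).

- In the direct sum this is immediate once the support of [A] is finite.
- In the product, a single continuous functional depends on finitely many
  coordinates ([prod_dual_finite_support]), but the sequence has to be treated
  as a whole.  If the coordinates involved were not confined to a finite set, a
  gliding hump would build one point [x] of the product, coordinate block after
  coordinate block, with [chi n x = 1] for infinitely many [n]
  ([gliding_hump]); this contradicts [chi n x --> 0].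

It remains to see that a limited subset of the direct sum has finite support
([limited_support]).  Otherwise there are distinct indices [i_n] and points
[x_n] of [A] with a nonzero [i_n]-th coordinate; the spaces being Hausdorff,
some [chi_n] in the dual of [E (i_n)] takes the value 1 there.  The functionals
[chi_n \o coord (i_n)] on the direct sum are equicontinuous, because at most one of
them is nonzero on any given summand, and weak* p-summable, because a point has
only finitely many nonzero coordinates; yet they stay of seminorm at least 1 on
[A].

The functional [chi_n] comes from the Hahn-Banach theorem, proved below in the
form: a sublinear functional dominates an additive, real-homogeneous one with
the same value at a given point ([Hahn_Banach]).  Since a minimal sublinear
functional is automatically linear, Zorn's lemma applies to everywhere-defined
functions and no extension from subspaces is involved.  It is applied to the
gauge of a convex neighborhood, and a complex functional is recovered from its
real part. *)

(** * Hahn-Banach theorem *)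

Section Sublinear.
Variables (R : realType) (K : pzRingType) (r : {rmorphism R -> K}).
Variable V : lmodType K.
Implicit Types (p q : V -> R) (x y v : V) (t : R).

(** Vectors are scaled through a ring morphism [r] from the reals, so that one
    statement covers real spaces and complex ones seen as real spaces. *)
Definition sublinear p :=
  (forall x y, p (x + y) <= p x + p y) /\
  (forall t x, 0 < t -> p (r t *: x) <= t * p x).

Lemma sublinear0 p : sublinear p -> p 0 = 0.
Proof.
move=> [_ pZ].
have := pZ 2 0; have := pZ 2^-1 0; rewrite !scaler0.
rewrite invr_gt0 ltr0n => /(_ isT) h1 /(_ isT) h2.
by apply/eqP; rewrite eq_le; apply/andP; split; lra.
Qed.

Lemma sublinear_geN p x : sublinear p -> - p (- x) <= p x.
Proof.
by move=> sp; have [pD _] := sp; have := pD x (- x); rewrite subrr sublinear0 //; lra.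
Qed.

Lemma sublinearZ p t x : sublinear p -> 0 <= t -> p (r t *: x) = t * p x.
Proof.
move=> sp; rewrite le_eqVlt => /predU1P[<-|t0].
  by rewrite rmorph0 scale0r mul0r sublinear0.
have [_ pZ] := sp; apply/eqP; rewrite eq_le pZ //=.
have := pZ t^-1 (r t *: x); rewrite invr_gt0 => /(_ t0).
rewrite scalerA -rmorphM mulVf ?gt_eqF // rmorph1 scale1r => h.
by rewrite mulrC -ler_pdivlMr // mulrC.
Qed.

(** The pointwise infimum is subadditive because, the family being a chain, the
    smaller of any two members bounds both; it is finite because every member
    is bounded below at [x] by [- p (- x)]. *)
Lemma sublinear_inf_chain p (A : set (V -> R)) :
  A !=set0 -> (forall q, A q -> sublinear q /\ forall x, q x <= p x) ->
  (forall q q', A q -> A q' -> (forall x, q x <= q' x) \/ (forall x, q' x <= q x)) ->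
  exists2 m, sublinear m & forall q x, A q -> m x <= q x.
Proof.
move=> [q0 Aq0] Ap chA; pose S x := [set q x | q in A].
have S0 x : S x !=set0 by exists (q0 x), q0.
have Slb x : has_lbound (S x).
  exists (- p (- x)) => _ [q Aq <-]; have [sq qp] := Ap _ Aq.
  by apply: le_trans (sublinear_geN x sq); rewrite lerN2.
have mA q x : A q -> inf (S x) <= q x by move=> Aq; apply: ge_inf => //; exists q.
exists (fun x => inf (S x)) => //; split.
  move=> x y; rewrite -lerBlDr; apply: lb_le_inf => // _ [q Aq <-].
  rewrite lerBlDr [leRHS]addrC -lerBlDr; apply: lb_le_inf => // _ [q' Aq' <-].
  rewrite lerBlDr.
  case: (chA _ _ Aq Aq') => [qq'|q'q].
    rewrite (le_trans (mA q _ Aq)) // (le_trans ((Ap q Aq).1.1 x y)) //.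
    by have := qq' y; lra.
  rewrite (le_trans (mA q' _ Aq')) // (le_trans ((Ap q' Aq').1.1 x y)) //.
  by have := q'q x; lra.
move=> t x t0; rewrite mulrC -ler_pdivrMr //; apply: lb_le_inf => // _ [q Aq <-].
rewrite ler_pdivrMr // mulrC (le_trans (mA q _ Aq)) //.
exact: (Ap q Aq).1.2.
Qed.

(** The witness is [q x = inf_(t >= 0) p (x + t v) - t p v]; taking [t = 1] at
    [- v] gives [q (- v) <= p 0 - p v].  This is how a minimal sublinear
    functional is forced to be odd, hence linear. *)
Lemma sublinear_shrink p v : sublinear p ->
  exists q, [/\ sublinear q, forall x, q x <= p x & q (- v) <= - p v].
Proof.
move=> sp; have [pD pZ] := sp.
pose S x := [set p (x + r t *: v) - t * p v | t in [set t | 0 <= t]].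
have S0 x : S x !=set0 by exists (p (x + r 0 *: v) - 0 * p v), 0 => /=.
have Slb x : has_lbound (S x).
  exists (- p (- x)) => _ [t /= t0 <-].
  rewrite -(sublinearZ v sp t0) lerNl opprB lerBlDr.
  by apply: le_trans (pD _ _); rewrite addKr.
have qS x t : 0 <= t -> inf (S x) <= p (x + r t *: v) - t * p v.
  by move=> t0; apply: ge_inf => //; exists t.
exists (fun x => inf (S x)); split; first split.
- move=> x y; rewrite -lerBlDr; apply: lb_le_inf => // _ [t /= t0 <-].
  rewrite lerBlDr [leRHS]addrC -lerBlDr; apply: lb_le_inf => // _ [t' /= t'0 <-].
  rewrite lerBlDr (le_trans (qS _ (t + t') _)) ?addr_ge0 //.
  rewrite rmorphD scalerDl addrACA.
  have := pD (x + r t *: v) (y + r t' *: v); lra.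
- move=> t x t0; rewrite mulrC -ler_pdivrMr //.
  apply: lb_le_inf => // _ [t' /= t'0 <-].
  rewrite ler_pdivrMr // mulrC (le_trans (qS _ (t * t') _)) ?mulr_ge0 ?(ltW t0) //.
  rewrite rmorphM -scalerA -scalerDr mulrBr mulrA lerB //.
  exact: pZ.
- by move=> x; have := qS x 0; rewrite lexx rmorph0 scale0r addr0 mul0r subr0; apply.
- have := qS (- v) 1; rewrite rmorph1 scale1r addNr sublinear0 // mul1r sub0r.
  by apply; rewrite ler01.
Qed.

(** Shrink [p] along [v] first, then take a minimal sublinear functional below
    the result: the bound [f (- v) <= - p v] survives the second step and, [f]
    being odd, becomes [p v <= f v]. *)
Theorem Hahn_Banach p v : sublinear p -> exists f : V -> R,
  [/\ forall x y, f (x + y) = f x + f y, forall t x, f (r t *: x) = t * f x,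
      forall x, f x <= p x & p v <= f v].
Proof.
move=> sp; have [p' [sp' p'p p'v]] := sublinear_shrink v sp.
pose T := {q : V -> R | sublinear q /\ forall x, q x <= p' x}.
pose ge (q q' : T) := `[< forall x, sval q' x <= sval q x >].
have [| | |m minm] := @ZL_preorder T (exist _ p' (conj sp' (fun x => lexx _))) ge.
- by move=> q; apply/asboolP.
- move=> q1 q2 q3 /asboolP h1 /asboolP h2; apply/asboolP => x.
  exact: le_trans (h2 x) (h1 x).
- move=> A totA; have [[q0 Aq0]|/nonemptyPn A0] := pselect (A !=set0); last first.
    by exists (exist _ p' (conj sp' (fun x => lexx _))) => q; rewrite A0.
  have [||q q' [/= s As <-] [s' As' <-]|m sm mA] :=
      @sublinear_inf_chain p' [set sval q | q in A].
  + by exists (sval q0), q0.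
  + by move=> _ [q _ <-]; exact: (svalP q).
  + by case: (totA _ _ As' As) => /asboolP; [left|right].
  have mp' x : m x <= p' x.
    by apply: le_trans ((svalP q0).2 x); apply: mA; exists q0.
  exists (exist _ m (conj sm mp')) => q Aq; apply/asboolP => x /=.
  by apply: mA; exists q.
have [sm mp'] := svalP m.
have mN x : sval m (- x) = - sval m x.
  apply/eqP; rewrite eq_le lerNl; apply/andP; split; last first.
    by have := sublinear_geN (- x) sm; rewrite opprK lerNl.
  have [q [sq qm qx]] := sublinear_shrink x sm.
  have qp' y : q y <= p' y by apply: le_trans (mp' y).
  have /asboolP/(_ (- x)) /= mq : ge (exist _ q (conj sq qp')) m.
    by apply: minm; apply/asboolP.
  by rewrite (le_trans mq).
exists (sval m); split.
- move=> x y; apply/eqP; rewrite eq_le sm.1 /=.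
  by have := sm.1 (- x) (- y); rewrite -opprD !mN; lra.
- move=> t x; have [t0|t0] := leP 0 t; first exact: sublinearZ.
  have := sublinearZ x sm (t := - t); rewrite oppr_ge0 (ltW t0) => /(_ isT).
  by rewrite rmorphN scaleNr mN mulNr => /oppr_inj.
- by move=> x; apply: le_trans (p'p x).
- by rewrite -lerN2 -mN (le_trans (mp' _)).
Qed.

End Sublinear.

(** * Real and complex scalars *)

Section Scalars.
Variables (R : realType) (k : scalar_kind).
Notation K := (scalars R k).

Definition of_real : {rmorphism R -> K} :=
  match k return {rmorphism R -> scalars R k} with
  | RealScalars => idfun
  | ComplexScalars => real_complex R
  end.

Lemma normr_modulus (x : K) : `|x| = of_real (modulus x).
Proof. by rewrite /of_real; move: x; case: k. Qed.

Lemma ler_of_real (a b : R) : (of_real a <= of_real b) = (a <= b).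
Proof. by rewrite /of_real; case: k => //=; rewrite lecE /= eqxx. Qed.

Lemma ltr_of_real (a b : R) : (of_real a < of_real b) = (a < b).
Proof. by rewrite /of_real; case: k => //=; rewrite ltcE /= eqxx. Qed.

Lemma modulus_ge0 (x : K) : 0 <= modulus x.
Proof. by rewrite -ler_of_real rmorph0 -normr_modulus. Qed.

Lemma modulusM (x y : K) : modulus (x * y) = modulus x * modulus y.
Proof.
by apply: (fmorph_inj of_real); rewrite rmorphM -!normr_modulus normrM.
Qed.

Lemma ler_modulusD (x y : K) : modulus (x + y) <= modulus x + modulus y.
Proof. by rewrite -ler_of_real rmorphD /= -!normr_modulus ler_normD. Qed.

Lemma modulus0 : modulus (0 : K) = 0.
Proof. by apply: (fmorph_inj of_real); rewrite -normr_modulus normr0 rmorph0. Qed.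

Lemma modulus1 : modulus (1 : K) = 1.
Proof. by apply: (fmorph_inj of_real); rewrite -normr_modulus normr1 rmorph1. Qed.

Lemma modulus_of_real (t : R) : modulus (of_real t) = `|t|.
Proof.
rewrite /of_real; case: k => //=.
by rewrite /ComplexField.Normc.normc /= expr0n addr0 sqrtr_sqr.
Qed.

Lemma gt0_of_real (e : K) : 0 < e -> of_real (modulus e) = e.
Proof. by move=> e0; rewrite -normr_modulus gtr0_norm. Qed.

Lemma modulus_gt0 (e : K) : 0 < e -> 0 < modulus e.
Proof. by move=> e0; rewrite -ltr_of_real rmorph0 gt0_of_real. Qed.

(** In the complex case [g x = f x - i f (i x)], whose real part is [f], and
    [c] is the imaginary unit. *)
Lemma real_linear_extension (V : lmodType K) (f : V -> R) :
  (forall x y, f (x + y) = f x + f y) ->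
  (forall t x, f (of_real t *: x) = t * f x) ->
  exists g : {linear V -> K^o}, exists c : K, forall x,
    `|f x| <= modulus (g x) <= `|f x| + `|f (c *: x)|.
Proof.
rewrite /of_real; move: V f; case: k => /= V f fD fZ.
  have lf : linear (f : V -> R^o) by move=> a x y; rewrite fD fZ.
  pose L := GRing.isLinear.Build R V R^o *:%R f lf.
  pose g : {linear V -> R^o} := HB.pack f L.
  by exists g; exists 0 => x; rewrite /= lexx lerDl normr_ge0.
have f0 : f 0 = 0 by have := fZ 0 0; rewrite scaler0 mul0r.
have fN x : f (- x) = - f x.
  by apply/eqP; rewrite -addr_eq0 -fD addNr f0.
pose i : R[i] := (0 +i* 1)%C.
pose h (x : V) : R[i] := (f x +i* (- f (i *: x)))%C.
have lh : linear (h : V -> R[i]^o).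
  move=> [a b] x y.
  have abE : (a +i* b)%C = real_complex R a + real_complex R b * i.
    by rewrite /i; simpc.
  rewrite /h scalerDr !fD abE scalerDl !scalerDr -!scalerA !fD.
  have -> : i *: (real_complex R a *: x) = real_complex R a *: (i *: x).
    by rewrite !scalerA mulrC.
  have -> : i *: (real_complex R b *: (i *: x)) = - (real_complex R b *: x).
    by rewrite !scalerA mulrAC -scaleNr /i; congr (_ *: _); simpc.
  rewrite fN !fZ. rewrite /GRing.scale /=; simpc.
  congr (_ +i* _)%C; lra.
pose L := GRing.isLinear.Build R[i] V R[i]^o *:%R h lh.
pose g : {linear V -> R[i]^o} := HB.pack h L.
exists g, i => x; rewrite /= sqrrN; apply/andP; split.
  by rewrite -sqrtr_sqr ler_wsqrtr // lerDl sqr_ge0.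
rewrite -[leRHS]ger0_norm ?addr_ge0 // -[leRHS]sqrtr_sqr ler_wsqrtr //.
rewrite sqrrD !real_normK ?num_real // [leRHS]addrAC lerDl.
by rewrite mulrn_wge0 // mulr_ge0.
Qed.

End Scalars.
Arguments of_real {R} k.

(** * Separating points by continuous functionals *)

Section Separation.
Variables (R : realType) (k : scalar_kind) (E : tvsType (scalars R k)).
Notation K := (scalars R k).

Lemma near0_modulus (e : R) : 0 < e -> \forall a \near (0 : K^o), modulus a < e.
Proof.
move=> e0; exists (of_real k e); first by rewrite /= -(rmorph0 (of_real k)) ltr_of_real.
by move=> a; rewrite /ball_ /= sub0r normrN normr_modulus ltr_of_real.
Qed.

(** The radius [e] ranges over the reals, whereas the metric of the scalars has
    its radii in the scalar field itself. *)
Lemma linear_near0_continuous (g : {linear E -> K^o}) :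
  (forall e : R, 0 < e -> \forall x \near (0 : E), modulus (g x) <= e) ->
  continuous g.
Proof.
move=> g0 x; apply/cvgrPdist_le => e e0.
have := nbhsT x (g0 _ (modulus_gt0 e0)); apply: filterS => _ [y /= gy <-].
by rewrite linearD opprD addNKr normrN normr_modulus -(gt0_of_real e0) ler_of_real.
Qed.

Variables (U : set E).
Hypotheses (U0 : nbhs 0 U) (cU : forall (l : R) x y, 0 <= l <= 1 ->
  U x -> U y -> U (of_real k l *: x + of_real k (1 - l) *: y)).

Let S (x : E) : set R := [set t | 0 < t /\ U (of_real k t^-1 *: x)].

Definition gauge (x : E) : R := inf (S x).

Let S_neq0 x : S x !=set0.
Proof.
have /= := @scale_continuous K E (0, x) U.
rewrite scale0r => /(_ U0) [[/= A B] [/= [r r0 rA] Bx] AB].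
exists (2 / modulus r); split; first by rewrite divr_gt0 // modulus_gt0.
apply: (AB (_, x)); split => /=; last exact: nbhs_singleton.
apply: rA; rewrite /ball_ /= sub0r normrN normr_modulus modulus_of_real.
rewrite -[ltRHS]gt0_of_real // ltr_of_real invf_div ger0_norm.
  by rewrite ltr_pdivrMr // ltr_pMr ?modulus_gt0 // ltr1n.
by rewrite divr_ge0 // modulus_ge0.
Qed.

Let S_lb x : has_lbound (S x).
Proof. by exists 0 => t [/ltW]. Qed.

Lemma gauge_le x t : 0 < t -> U (of_real k t^-1 *: x) -> gauge x <= t.
Proof. by move=> t0 Ut; apply: ge_inf => //; split. Qed.

Lemma gauge_sublinear : sublinear (of_real k) gauge.
Proof.
split=> [x y|t x t0].
  rewrite -lerBlDr; apply: lb_le_inf => // s [s0 Us].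
  rewrite lerBlDr [leRHS]addrC -lerBlDr; apply: lb_le_inf => // t [t0 Ut].
  rewrite lerBlDr; apply: gauge_le; first by rewrite addr_gt0.
  have st0 : t + s != 0 by rewrite gt_eqF // addr_gt0.
  rewrite [X in U X](_ : _ = of_real k (s / (t + s)) *: (of_real k s^-1 *: x) +
      of_real k (1 - s / (t + s)) *: (of_real k t^-1 *: y)).
    apply: cU => //; rewrite divr_ge0 ?addr_ge0 ?(ltW s0) ?(ltW t0) //=.
    by rewrite ler_pdivrMr ?addr_gt0 // mul1r lerDr ltW.
  rewrite !scalerA -!rmorphM scalerDr; congr (of_real k _ *: _ + of_real k _ *: _).
    by field; rewrite st0 gt_eqF.
  by field; rewrite st0 gt_eqF.
rewrite mulrC -ler_pdivrMr //; apply: lb_le_inf => // s [s0 Us].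
rewrite ler_pdivrMr //; apply: gauge_le; first exact: mulr_gt0.
by rewrite scalerA -rmorphM invfM mulfVK ?gt_eqF.
Qed.

Lemma gauge_ge1 x : ~ U x -> 1 <= gauge x.
Proof.
move=> nUx; apply: lb_le_inf => // t [t0 Ut]; rewrite leNgt; apply/negP => t1.
apply: nUx.
have -> : x = of_real k t *: (of_real k t^-1 *: x) + of_real k (1 - t) *: 0.
  by rewrite scaler0 addr0 scalerA -rmorphM mulfV ?gt_eqF // rmorph1 scale1r.
by apply: cU => //; [rewrite (ltW t0) (ltW t1)|exact: nbhs_singleton].
Qed.

Lemma gauge_near0 (e : R) : 0 < e -> \forall x \near (0 : E), gauge x <= e.
Proof.
move=> e0; have ke0 : of_real k e != 0 by rewrite fmorph_eq0 gt_eqF.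
have := nbhs0Z ke0 U0; apply: filterS => _ [x Ux <-].
by apply: gauge_le => //; rewrite scalerA -rmorphM mulVf ?gt_eqF // rmorph1 scale1r.
Qed.

(** A real functional below the gauge is continuous since the gauge is small
    near 0; the value at [x] is at least [gauge x >= 1]. *)
Lemma separation x : ~ U x -> exists chi : topdual E, chi x != 0.
Proof.
move=> nUx.
have [f [fD fZ fg fx]] := Hahn_Banach x gauge_sublinear.
have [g [c gf]] := real_linear_extension fD fZ.
have f0 : f 0 = 0 by have := fZ 0 0; rewrite scaler0 mul0r.
have fN y : f (- y) = - f y by apply/eqP; rewrite -addr_eq0 -fD addNr f0.
have f_near0 e : 0 < e -> \forall y \near (0 : E), `|f y| <= e.
  move=> e0; have g0 := gauge_near0 e0.
  apply: filterS (filterI g0 (nbhs0N g0)) => y [/= gy [z /= gz zy]].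
  rewrite ler_norml (le_trans (fg _) gy) andbT lerNl -fN -zy opprK.
  exact: le_trans (fg _) gz.
have cg : continuous g.
  apply: linear_near0_continuous => e e0.
  have e20 : 0 < e / 2 by rewrite divr_gt0.
  have h1 := f_near0 _ e20.
  have h2 : \forall y \near (0 : E), `|f (c *: y)| <= e / 2.
    have : (fun y : E => c *: y) @ (0 : E) --> (0 : E).
      rewrite -[X in _ --> X](scaler0 _ c).
      apply: (@continuous_comp E (K^o * E)%type E (fun y => (c, y))
        (fun z => z.1 *: z.2)); last exact: scale_continuous.
      by apply: (@cvg_pair _ _ _ _ (nbhs (c : K^o))); [exact: cvg_cst|exact: cvg_id].
    by move=> /(_ _ h1).
  apply: filterS (filterI h1 h2) => y [/= fy fcy].
  by have /andP[_ /le_trans] := gf y; apply; rewrite [leRHS]splitr lerD.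
exists (TopDual cg) => /=; apply/eqP => gx0.
have /andP[+ _] := gf x; rewrite gx0 modulus0 normr_le0 => /eqP fx0.
by have := le_trans (gauge_ge1 nUx) fx; rewrite fx0 ler10.
Qed.

End Separation.

Section ConvexNeighborhoods.
Variables (R : realType) (k : scalar_kind) (E : tvsType (scalars R k)).
Notation K := (scalars R k).

Lemma convex_nbhs0 (A : set E) : nbhs 0 A -> exists U : set E,
  [/\ nbhs 0 U, U `<=` A & forall (l : R) x y, 0 <= l <= 1 ->
    U x -> U y -> U (of_real k l *: x + of_real k (1 - l) *: y)].
Proof.
have [B cB [oB /[apply]]] := @locally_convex _ E.
move=> [U [BU U0] UA]; exists U; split => //.
  by apply: open_nbhs_nbhs; split => //; exact: oB.
move=> l x y /andP[l0 l1] Ux Uy.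
have kl0 : 0 <= of_real k l by rewrite -(rmorph0 (of_real k)) ler_of_real.
have kl1 : of_real k l <= 1 by rewrite -(rmorph1 (of_real k)) ler_of_real.
have := cB U (mem_set BU) x y (Itv01 kl0 kl1) (mem_set Ux) (mem_set Uy).
by move=> /set_mem; rewrite rmorphB rmorph1.
Qed.

(** The points whose whole scalar disc stays in a convex neighborhood [U] form
    an absolutely convex set; joint continuity of scaling at [(0, 0)] makes it a
    neighborhood. *)
Lemma absolutely_convex_nbhs0 (A : set E) : nbhs 0 A ->
  exists2 W : set E, absolutely_convex W & nbhs 0 W /\ W `<=` A.
Proof.
move=> /convex_nbhs0[U [U0 UA cU]].
exists [set x | forall c : K, modulus c <= 1 -> U (c *: x)].
  split=> [c _|a b x y]; first by rewrite scaler0; exact: nbhs_singleton.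
  rewrite !normr_modulus -rmorphD -[1](rmorph1 (of_real k)) ler_of_real.
  move=> ab Ux Uy c c1.
  (* For t = 0 the division is by zero, but then d = 0 as well. *)
  have ca1 (d : K) (t : R) : modulus d <= t ->
      of_real k t * (c * d / of_real k t) = c * d /\
      modulus (c * d / of_real k t) <= 1.
    move=> dt; have t0 := le_trans (modulus_ge0 d) dt.
    have [tE|tn0] := eqVneq t 0.
      have -> : d = 0.
        apply/eqP; rewrite -normr_le0 normr_modulus -(rmorph0 (of_real k)).
        by rewrite ler_of_real -tE.
      by rewrite mulr0 mul0r mulr0 modulus0.
    have kt0 : of_real k t != 0 by rewrite fmorph_eq0.
    split; first by rewrite mulrC divfK.
    rewrite -fmorphV !modulusM modulus_of_real normfV ger0_norm //.
    by rewrite ler_pdivrMr ?lt0r ?tn0 // mul1r -[leRHS]mul1r ler_pM // modulus_ge0.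
  have [ea ma] := ca1 a _ (lexx _).
  (* The weights of the real convex combination are |a| and 1 - |a| >= |b|. *)
  have [|eb mb] := ca1 b (1 - modulus a); first by rewrite lerBrDl.
  rewrite scalerDr !scalerA -ea -eb -!scalerA; apply: cU.
  - by rewrite modulus_ge0 (le_trans _ ab) // lerDl modulus_ge0.
  - by rewrite !scalerA; exact: Ux.
  - by rewrite !scalerA; exact: Uy.
split=> [|x Wx]; last by apply: UA; rewrite -[x]scale1r; apply: Wx; rewrite modulus1.
have /= := @scale_continuous K E (0, 0) U.
rewrite scale0r => /(_ U0) [[/= A' B] [/= [r r0 rA] B0] AB].
have r20 : r / 2 != 0 by rewrite mulf_neq0 ?invr_eq0 ?pnatr_eq0 // gt_eqF.
have := nbhs0Z r20 B0; apply: filterS => _ [x Bx <-] c c1; rewrite scalerA.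
apply: (AB (_, x)); split => //=; apply: rA; rewrite /ball_ /= sub0r normrN normrM.
apply: (@le_lt_trans _ _ `|r / 2|).
  by rewrite ler_piMl // normr_modulus -(rmorph1 (of_real k)) ler_of_real.
by rewrite ger0_norm ?divr_ge0 ?(ltW r0) // ltr_pdivrMr // ltr_pMr // ltr1n.
Qed.

Lemma linear_near0_equicontinuous (chi : nat -> topdual E) :
  (forall e : R, 0 < e -> \forall x \near (0 : E), forall n, modulus (chi n x) <= e) ->
  dual_equicontinuous chi.
Proof.
move=> chi0 x U; rewrite -entourage_ballE => -[e /= e0 eU].
have e20 : 0 < modulus e / 2 by rewrite divr_gt0 // modulus_gt0.
have := nbhsT x (chi0 _ e20); apply: filterS => _ [y /= chiy <-] n _.
apply: eU; rewrite /= -ball_normE /ball_ /= linearD opprD addNKr normrN.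
rewrite normr_modulus -(gt0_of_real e0) ltr_of_real (le_lt_trans (chiy n)) //.
by rewrite gtr_pMr ?modulus_gt0 // invf_lt1 // ltr1n.
Qed.

End ConvexNeighborhoods.

Lemma hausdorff_separation (R : realType) (k : scalar_kind)
    (E : tvsType (scalars R k)) (x : E) :
  hausdorff_space E -> x != 0 -> exists chi : topdual E, chi x = 1.
Proof.
move=> hE x0.
have [A [oA A0 Ax]] : exists A : set E, [/\ open A, A 0 & ~ A x].
  have /(_ 0 x) := hausdorff_accessible hE; rewrite eq_sym x0 => /(_ isT).
  by move=> [A [oA /set_mem A0 /set_mem Ax]]; exists A.
have [U [U0 UA cU]] := convex_nbhs0 (open_nbhs_nbhs (conj oA A0)).
have [chi chix] := separation U0 cU (fun Ux => Ax (UA _ Ux)).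
have cs : continuous ((chi x)^-1 \*: chi : E -> (scalars R k)^o).
  by move=> y; apply: cvgZl_tmp; exact: dual_continuous.
exists (TopDual cs); exact: mulVf.
Qed.

(** * Summability of extended real sequences *)

Section LpTails.
Variable R : realType.
Implicit Types (p q : \bar R) (u v : nat -> \bar R).
Local Open Scope ereal_scope.

Lemma le_poweR (r : R) (x y : \bar R) : (0 <= r)%R -> 0 <= x -> x <= y ->
  x `^ r <= y `^ r.
Proof.
move=> r0 x0 xy; apply: gt0_ler_poweR => //; rewrite in_itv /= leey andbT //.
exact: le_trans xy.
Qed.

Lemma lp_c0_le q u v : 1 <= q -> (forall n, 0 <= u n) ->
  (forall n, u n <= v n) -> lp_c0 q v -> lp_c0 q u.
Proof.
case: q => [r| |] //= r1 u0 uv; last first.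
  move=> v0; apply: (@squeeze_cvge _ _ _ _ (cst 0) u v) => //; last exact: cvg_cst.
  by near=> n; rewrite u0 uv.
apply: le_lt_trans; apply: lee_nneseries => n _.
  by move=> _; exact: poweR_ge0.
have r0 : (0 <= r)%R by move: r1; rewrite lee_fin; apply: le_trans.
exact: le_poweR.
Unshelve. all: by end_near. Qed.

Lemma lp_c0D q u v : 1 <= q -> (forall n, 0 <= u n) -> (forall n, 0 <= v n) ->
  lp_c0 q u -> lp_c0 q v -> lp_c0 q (fun n => u n + v n).
Proof.
case: q => [r| |] //= r1 u0 v0; last first.
  by move=> hu hv; rewrite -[X in _ --> X]adde0; apply: cvgeD.
move=> hu hv.
have r0 : (0 <= r)%R by move: r1; rewrite lee_fin; apply: le_trans.
(* u + v <= 2 max(u, v), and the power of the maximum is one of the two powers. *)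
have uv n : (u n + v n) `^ r <= (2 `^ r)%R%:E * (u n `^ r + v n `^ r).
  have m0 : 0 <= maxe (u n) (v n) by rewrite le_max u0.
  have le2 : u n + v n <= 2%:E * maxe (u n) (v n).
    by rewrite mule_natl mule2n; apply: leeD; rewrite le_max lexx ?orbT.
  apply: (@le_trans _ _ ((2%:E * maxe (u n) (v n)) `^ r)).
    by apply: le_poweR => //; exact: adde_ge0.
  rewrite poweRM // poweR_EFin; apply: lee_pmul => //.
    exact: poweR_ge0.
  rewrite /maxe; case: ifP => _.
    by rewrite leeDr // poweR_ge0.
  by rewrite leeDl // poweR_ge0.
apply: (@le_lt_trans _ _ (\sum_(0 <= n <oo) (2 `^ r)%R%:E * (u n `^ r + v n `^ r))).
  by apply: lee_nneseries => // n _ _; exact: poweR_ge0.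
rewrite nneseriesZl; last by move=> *; rewrite adde_ge0 ?poweR_ge0.
rewrite nneseriesD; [|by move=> *; exact: poweR_ge0..].
apply: lte_mul_pinfty; rewrite ?lee_fin ?powR_ge0 //.
by rewrite lte_add_pinfty.
Qed.

Lemma lp_c0_finite q (a : nat -> R) (N : nat) : 1 <= q ->
  (forall n, (0 <= a n)%R) -> (forall n, (N <= n)%N -> a n = 0%R) ->
  lp_c0 q (fun n => (a n)%:E).
Proof.
case: q => [r| |] //= r1 a0 aN; last first.
  apply: cvg_near_cst; exists N => // n /= /aN ->.
  by [].
have r0 : r != 0%R by rewrite gt_eqF //; move: r1; rewrite lee_fin; apply: lt_le_trans.
rewrite (@nneseries_split _ _ 0%N N); last by move=> *; rewrite lee_fin powR_ge0.
rewrite [X in _ + X]eseries0; last first.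
  by move=> n + _; rewrite add0n => /aN ->; rewrite powR0.
by rewrite adde0; apply: lte_sum_pinfty => n _; rewrite ltry.
Qed.

Lemma lp_c0_sum q (J : eqType) (s : seq J) (u : J -> nat -> \bar R) : 1 <= q ->
  (forall j n, 0 <= u j n) -> {in s, forall j, lp_c0 q (u j)} ->
  lp_c0 q (fun n => \sum_(j <- s) u j n).
Proof.
move=> q1 u0; elim: s => [_|j s IH us].
  under eq_fun do rewrite big_nil.
  exact: (@lp_c0_finite q (fun=> 0%R) 0%N).
under eq_fun do rewrite big_cons.
apply: lp_c0D => //.
- by move=> n; apply: sume_ge0.
- by apply: us; rewrite mem_head.
- by apply: IH => i si; apply: us; rewrite in_cons si orbT.
Qed.

(** For a finite exponent each power is bounded by the tail of the series, which
    tends to 0. *)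
Lemma lp_c0_lt1 q u : 1 <= q -> (forall n, 0 <= u n) -> lp_c0 q u ->
  \forall n \near \oo, u n < 1.
Proof.
case: q => [r| |] //= r1 u0 hu; last first.
  exact: (hu [set y | y < 1] (@open_ereal_lt' _ 0 1 lte01)).
have r0 : (0 <= r)%R by move: r1; rewrite lee_fin; apply: le_trans.
have tail : \forall N \near \oo, \sum_(N <= n <oo) u n `^ r < 1.
  exact: (nneseries_tail_cvg hu (fun n _ => poweR_ge0 (u n) r)
    (@open_ereal_lt' _ 0 1 lte01)).
apply: filterS tail => N; apply: contraTT; rewrite -!leNgt => u1.
rewrite (@nneseries_split _ _ N 1); last (by move=> n _; apply: poweR_ge0).
rewrite addn1 big_nat1 -[leLHS]adde0 leeD //; last first.
  by apply: nneseries_ge0 => n _ _; exact: poweR_ge0.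
by rewrite -(poweR1r r) le_poweR.
Qed.

End LpTails.

(** * Limited sets and linear maps *)

Section LimitedFor.
Variables (R : realType) (k : scalar_kind).
Notation K := (scalars R k).
Implicit Types (E F : tvsType K) (b : bool) (p q : \bar R).

(** Both notions at once: the flag [b] selects the equicontinuous variant. *)
Definition limited_for E b p q (A : set E) : Prop :=
  A !=set0 /\ forall chi : nat -> topdual E,
    (b -> dual_equicontinuous chi) -> weak_star_summable p chi ->
    lp_c0 q (fun n => dual_seminorm A (chi n)).

Lemma limitedP E p q (A : set E) : limited p q A <-> limited_for false p q A.
Proof.
by split=> -[A0 lA]; split=> // chi; [move=> _; exact: lA|move=> cs; exact: lA].
Qed.

Lemma E_limitedP E p q (A : set E) : E_limited p q A <-> limited_for true p q A.
Proof.
split=> -[A0 lA]; split=> // chi eq cs; apply: lA => //.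
exact: eq.
Qed.

Section Comp.
Variables (E F : tvsType K) (f : {linear E -> F}) (cf : continuous f).

Lemma dual_comp_continuous (chi : topdual F) :
  continuous (chi \o f : E -> K^o).
Proof.
by move=> x; apply: continuous_comp; [exact: cf|exact: dual_continuous].
Qed.

Definition dual_comp (chi : topdual F) : topdual E :=
  TopDual (@dual_comp_continuous chi).

Lemma dual_comp_equicontinuous (chi : nat -> topdual F) :
  dual_equicontinuous chi -> dual_equicontinuous (fun n => dual_comp (chi n)).
Proof. by move=> eq x U entU; exact: cf (eq (f x) U entU). Qed.

Lemma dual_comp_summable p (chi : nat -> topdual F) :
  weak_star_summable p chi -> weak_star_summable p (fun n => dual_comp (chi n)).
Proof. by move=> cs x; exact: cs. Qed.

Lemma dual_seminorm_comp (A : set E) (chi : topdual F) :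
  dual_seminorm A (dual_comp chi) = dual_seminorm (f @` A) chi.
Proof.
congr ereal_sup; apply/seteqP; split=> [_ [x [Ax|->] <-]|_ [_ [[x Ax <-]|->] <-]].
- by exists (f x) => //; left; exists x.
- by exists 0; [right|rewrite /= !linear0].
- by exists x => //; left.
- by exists 0; [right|rewrite /= !linear0].
Qed.

Lemma limited_image b p q (A : set E) :
  limited_for b p q A -> limited_for b p q (f @` A).
Proof.
move=> [[x Ax] lA]; split; first by exists (f x), x.
move=> chi eq cs; under eq_fun do rewrite -dual_seminorm_comp.
apply: lA; last exact: dual_comp_summable.
by move=> /eq; exact: dual_comp_equicontinuous.
Qed.

End Comp.

Lemma dual_seminorm_ge0 E (A : set E) (chi : topdual E) :
  (0 <= dual_seminorm A chi)%E.
Proof.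
apply: ereal_sup_ubound; exists 0; first by right.
by rewrite linear0 modulus0.
Qed.

Lemma modulus_le_dual_seminorm E (A : set E) (chi : topdual E) x :
  A x -> ((modulus (chi x))%:E <= dual_seminorm A chi)%E.
Proof. by move=> Ax; apply: ereal_sup_ubound; exists x => //; left. Qed.

(** Only finitely many coordinate sets contribute, so the sum of their seminorms
    dominates the seminorm of [A] and inherits q-summability. *)
Lemma limited_decomposition b p q E (J : eqType) (s : seq J)
    (F : J -> tvsType K) (P : forall j, E -> F j)
    (inj : forall j, {linear F j -> E}) (cinj : forall j, continuous (inj j))
    (A : set E) (chi : nat -> topdual E) : (1 <= q)%E ->
  (forall j, limited_for b p q (P j @` A)) ->
  (b -> dual_equicontinuous chi) -> weak_star_summable p chi ->
  (forall n x, A x -> chi n x = \sum_(j <- s) chi n (inj j (P j x))) ->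
  lp_c0 q (fun n => dual_seminorm A (chi n)).
Proof.
move=> q1 lP eq cs chiE.
pose chij j n := dual_comp (cinj j) (chi n).
apply: (@lp_c0_le _ _ _ (fun n =>
    \sum_(j <- s) dual_seminorm (P j @` A) (chij j n))%E) => //.
- by move=> n; exact: dual_seminorm_ge0.
- move=> n; apply: ub_ereal_sup => _ [x [Ax|->] <-]; last first.
    by rewrite linear0 modulus0; apply: sume_ge0 => j _; exact: dual_seminorm_ge0.
  rewrite chiE //.
  apply: (@le_trans _ _ (\sum_(j <- s) (modulus (chij j n (P j x)))%:E)%E); last first.
    by apply: lee_sum => j _; apply: modulus_le_dual_seminorm; exists x.
  rewrite sumEFin lee_fin; elim/big_ind2: _ => //; first by rewrite modulus0.
  by move=> u v w z uv wz; rewrite (le_trans (ler_modulusD _ _)) // lerD.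
apply: lp_c0_sum => // [j n|j _]; first exact: dual_seminorm_ge0.
apply: (lP j).2; last exact: dual_comp_summable.
by move=> /eq; exact: dual_comp_equicontinuous.
Qed.

End LimitedFor.

(** * Coordinates and injections *)

Section Coordinates.
Variables (K : numFieldType) (I : Type) (E : I -> tvsType K).
Notation P := (prod_topology E).
Notation S := (direct_sum E).

Let prod_coord_linear i : linear (@prod_coord K I E i).
Proof. by []. Qed.
HB.instance Definition _ i :=
  GRing.isLinear.Build K P (E i) *:%R (@prod_coord K I E i) (@prod_coord_linear i).

Let direct_sum_coord_linear i : linear (@direct_sum_coord K I E i).
Proof. by []. Qed.
HB.instance Definition _ i :=
  GRing.isLinear.Build K S (E i) *:%R (@direct_sum_coord K I E i)
    (@direct_sum_coord_linear i).

Definition prod_inj i (e : E i) : P := @dfwith {classic I} E (fun=> 0) i e.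

Lemma prod_inj_in i (e : E i) : prod_inj e i = e.
Proof. exact: (@dfwithin {classic I}). Qed.

Lemma prod_inj_out i j (e : E i) : i <> j -> prod_inj e j = 0.
Proof. by move=> ij; apply: (@dfwithout {classic I}); apply/eqP. Qed.

Let prod_inj_linear i : linear (@prod_inj i).
Proof.
move=> a x y; apply: functional_extensionality_dep => j.
change (prod_inj (a *: x + y) j = a *: prod_inj x j + prod_inj y j).
have [ij|ij] := pselect (i = j); last first.
  by rewrite !prod_inj_out // scaler0 addr0.
by case: j / ij; rewrite !prod_inj_in.
Qed.
HB.instance Definition _ i :=
  GRing.isLinear.Build K (E i) P *:%R (@prod_inj i) (@prod_inj_linear i).

Lemma prod_inj_continuous i : continuous (@prod_inj i).
Proof.
move=> x; apply/prod_cvgP => j.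
have [ij|ij] := pselect (i = j).
  case: j / ij; rewrite prod_inj_in.
  change ((fun y => prod_inj y i) @ x --> x).
  rewrite (_ : (fun y => _) = id); first exact: cvg_id.
  by apply/funext => y; rewrite prod_inj_in.
rewrite prod_inj_out //; change ((fun y => prod_inj y j) @ x --> (0 : E j)).
rewrite (_ : (fun y => _) = cst 0); first exact: cvg_cst.
by apply/funext => y; rewrite prod_inj_out.
Qed.

Let direct_sum_inj_linear i : linear (@direct_sum_inj K I E i).
Proof.
by move=> a x y; apply: val_inj; exact: (linearP (@prod_inj i)).
Qed.
HB.instance Definition _ i :=
  GRing.isLinear.Build K (E i) S *:%R (@direct_sum_inj K I E i)
    (@direct_sum_inj_linear i).

Lemma direct_sum_inj_continuous i : continuous (@direct_sum_inj K I E i).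
Proof.
move=> x A [V [_ nV] VA].
have := nbhsT x (nV i); apply: filterS => _ [y Vy <-] /=.
by rewrite linearD; exact: VA.
Qed.


Lemma sum_prod_inj (s : seq {classic I}) (x : P) (j : {classic I}) : uniq s ->
  (\sum_(i <- s) prod_inj (x i)) j = if j \in s then x j else 0.
Proof.
elim: s => [|i s IH] /=; first by rewrite big_nil.
move=> /andP[si us]; rewrite big_cons in_cons.
change (prod_inj (x i) j + (\sum_(i <- s) prod_inj (x i)) j =
  if (j == i) || (j \in s) then x j else 0).
rewrite IH //; have [->|ji] := eqVneq j i.
  by rewrite prod_inj_in (negbTE si) addr0.
by rewrite prod_inj_out ?add0r //= => ij; rewrite ij eqxx in ji.
Qed.

Lemma direct_sum_decomposition (s : seq {classic I}) (x : S) : uniq s ->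
  supp x `<=` [set` s] ->
  x = \sum_(i <- s) direct_sum_inj i (direct_sum_coord i x).
Proof.
move=> us xs; apply: val_inj; rewrite raddf_sum /=.
apply: functional_extensionality_dep => j.
rewrite -[RHS]/((\sum_(i <- s) prod_inj (direct_sum_val x i)) j) sum_prod_inj //.
by case: ifPn => // js; apply/eqP; apply: contraNT js => /xs.
Qed.

End Coordinates.

(** * Dual sequences of a product *)

Section ProductDual.
Variables (R : realType) (k : scalar_kind) (I : Type).
Variable E : I -> tvsType (scalars R k).
Notation K := (scalars R k).
Notation P := (prod_topology E).

Definition vanishes_on (s : seq {classic I}) : set P :=
  [set x | forall i : {classic I}, i \in s -> x i = 0].

(** The sets of vectors vanishing on a finite set of indices form a filter base
    converging to 0 in the product topology, so [chi] is bounded on one of them;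
    as that set is a subspace, [chi] vanishes on it. *)
Lemma prod_dual_finite_support (chi : topdual P) :
  exists s, forall x, vanishes_on s x -> chi x = 0.
Proof.
pose F : set_system P := filter_from setT vanishes_on.
have FF : Filter F.
  apply: filter_from_filter; first by exists [::].
  move=> s t _ _; exists (s ++ t) => // x st; split=> i si; apply: st;
    by rewrite mem_cat si ?orbT.
have F0 : F --> (0 : P).
  apply/prod_cvgP => i A A0; exists [:: i : {classic I}] => // x /= xi.
  by rewrite /= xi ?mem_seq1 //; exact: nbhs_singleton.
have : chi @ F --> (0 : K^o).
  by rewrite -(linear0 chi); apply: (cvg_comp _ _ F0); exact: dual_continuous.
move=> /(_ _ (near0_modulus k ltr01)) [s _ sF]; exists s => x xs.
apply/eqP; apply: contraT => chix.
have /sF /= : vanishes_on s ((chi x)^-1 *: x).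
  by move=> i /xs xi; rewrite -[LHS]/((chi x)^-1 *: x i) xi scaler0.
by rewrite linearZ /= -[_ *: _]/(_ * _) mulVf // modulus1 ltxx.
Qed.

(** One builds points [x_0, x_1, ...] and increasing ranks [n_0, n_1, ...] such that
    [chi (n_j) (x_j) = 1], where [x_(j+1)] agrees with [x_j] on every coordinate
    that [chi 0, ..., chi (n_j)] depend on.  The coordinatewise limit then agrees
    with [x_j] as far as [chi (n_j)] can tell. *)
Lemma gliding_hump (chi : nat -> topdual P) :
  (forall s : seq {classic I}, exists n x, vanishes_on s x /\ chi n x <> 0) ->
  exists x, forall N, exists2 n, (N <= n)%N & chi n x = 1.
Proof.
move=> unb.
have [sn snP] := choice (fun n => prod_dual_finite_support (chi n)).
pose S N := flatten [seq sn m | m <- iota 0 N.+1].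
have mem_S m N (i : {classic I}) : (m <= N)%N -> i \in sn m -> i \in S N.
  by move=> mN im; apply/flatten_mapP; exists m => //; rewrite mem_iota.
have S_le M N (i : {classic I}) : (M <= N)%N -> i \in S M -> i \in S N.
  move=> MN /flatten_mapP[m]; rewrite mem_iota /= add0n ltnS => mM.
  by apply: mem_S; exact: leq_trans MN.
have chi_eq n (x y : P) : (forall i : {classic I}, i \in S n -> x i = y i) -> chi n x = chi n y.
  move=> xy; apply/eqP; rewrite -subr_eq0 -linearB; apply/eqP/snP => i isn.
  by rewrite -[LHS]/(x i - y i) xy ?subrr //; exact: mem_S isn.
(* A state is a rank n together with the current point. *)
pose step (w w' : nat * P) := [/\ (w.1 < w'.1)%N,
  forall i : {classic I}, i \in S w.1 -> w'.2 i = w.2 i & chi w'.1 w'.2 = 1].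
have stepP w : exists w', step w w'.
  have [n [x [xS /eqP chix]]] := unb (S w.1).
  exists (n, w.2 + ((1 - chi n w.2) / chi n x) *: x); split=> /=.
  (* The chi m with m <= n only see coordinates in S n, where x vanishes. *)
  - rewrite ltnNge; apply: contra chix => nw; apply/eqP/snP => i isn.
    by apply: xS; exact: mem_S isn.
  - move=> i iS; rewrite -[LHS]/(w.2 i + _ *: x i) xS // scaler0 addr0 //.
  - by rewrite linearD linearZ /= -[_ *: _]/(_ * _) divfK // addrC subrK.
have [w [_ wP]] := dependent_choice (fun w => cid (stepP w)) (0%N, 0).
have w_lt m n : (m <= n)%N -> ((w m).1 <= (w n).1)%N.
  move=> /subnK <-; elim: (n - m)%N => // d IH; apply: leq_trans IH _.
  by have [/ltnW] := wP (d + m)%N.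
have w_eq m n (i : {classic I}) : (m <= n)%N -> i \in S (w m).1 -> (w n).2 i = (w m).2 i.
  move=> /subnK <- iS; elim: (n - m)%N => // d <-; have [_ -> //] := wP (d + m)%N.
  exact: S_le (w_lt _ _ (leq_addl d m)) iS.
(* Coordinate i is frozen as soon as i enters some S; before that its value is
   irrelevant, so any default rank will do. *)
pose x : P := fun i => (w (xget 0%N [set m | (i : {classic I}) \in S (w m).1])).2 i.
have x_eq m (i : {classic I}) : i \in S (w m).1 -> x i = (w m).2 i.
  move=> iS; rewrite /x; case: xgetP => [l _ /= il|/(_ m) //].
  by have [ml|/ltnW lm] := leqP m l; [exact: w_eq|rewrite (w_eq _ _ _ lm)].
exists x => N; exists (w N.+1).1.
  elim: N => // N IH; have [lt _ _] := wP N.+1; exact: leq_trans lt.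
by rewrite (chi_eq _ _ (w N.+1).2); [have [_ _] := wP N|exact: x_eq].
Qed.

Lemma weak_star_summable_support p (chi : nat -> topdual P) : (1 <= p)%E ->
  weak_star_summable p chi ->
  exists s, forall n x, vanishes_on s x -> chi n x = 0.
Proof.
move=> p1 cs; apply: contrapT => ns.
have [|x xP] := @gliding_hump chi.
  move=> s; apply: contrapT => ns'; apply: ns; exists s => n x xs.
  by apply: contrapT => chix; apply: ns'; exists n, x.
have [|N _ NP] := lp_c0_lt1 p1 _ (cs x); first by move=> n; rewrite lee_fin modulus_ge0.
have [n Nn chix] := xP N.
by have := NP n Nn; rewrite /= chix modulus1 ltxx.
Qed.

Lemma limited_prod b p q (A : set P) : inhabited I -> (1 <= p)%E -> (1 <= q)%E ->
  limited_for b p q A <-> forall i, limited_for b p q (prod_coord i @` A).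
Proof.
move=> [i0] p1 q1; split=> [lA i|lA].
  by apply: (limited_image (f := @prod_coord _ _ E i)) lA; exact: prod_proj_continuous.
have [_ [x0 Ax0 _]] := (lA i0).1.
split=> [|chi eq cs]; first by exists x0.
have [s sP] := weak_star_summable_support p1 cs.
apply: (@limited_decomposition R k b p q P {classic I} (undup s) E
  (fun i => prod_coord i) (fun i => @prod_inj _ _ E i)) => //.
  exact: prod_inj_continuous.
move=> n x _; rewrite -linear_sum; apply/eqP; rewrite -subr_eq0 -linearB.
apply/eqP/sP => i si; rewrite -[LHS]/(x i - (\sum_(j <- undup s) prod_inj (x j)) i).
by rewrite sum_prod_inj ?undup_uniq // mem_undup si subrr.
Qed.

End ProductDual.

(** * Dual sequences of a direct sum *)

Lemma infinite_injection (T : Type) (A : set T) : infinite_set A ->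
  exists f : nat -> T, injective f /\ forall n, A (f n).
Proof.
move=> /infiniteP/card_leP[f]; pose n_ n : [set: nat] := SigSub (mem_setT n).
exists (fun n => val (f (n_ n))); split=> [m n fmn|n]; last exact: set_valP.
have /(congr1 val) // : n_ m = n_ n by apply: 'inj_f; rewrite ?in_setT //; exact: val_inj.
Qed.

Lemma finite_nat_bounded (D : set nat) : finite_set D ->
  exists N, forall n, D n -> (n < N)%N.
Proof.
move=> /finite_seqP[s ->]; exists (\max_(n <- s) n).+1 => n /= ns.
by rewrite ltnS leq_bigmax_seq.
Qed.

Section DirectSumDual.
Variables (R : realType) (k : scalar_kind) (I : Type).
Variable E : I -> tvsType (scalars R k).
Notation K := (scalars R k).
Notation S := (direct_sum E).

(** Neighborhoods of 0 in the direct sum are given by absolutely convex sets,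
    hence the detour through absolutely convex neighborhoods in [E i]. *)
Lemma direct_sum_coord_continuous i : continuous (@direct_sum_coord K I E i).
Proof.
move=> x A xA.
have xA0 : nbhs 0 [set e | A (direct_sum_coord i x + e)].
  have := @add_continuous (E i) (direct_sum_coord i x, 0) A.
  rewrite /= addr0 => /(_ xA) [[/= B C] [Bx C0] BC].
  by apply: filterS C0 => e Ce; apply: (BC (_, e)); split => //=; exact: nbhs_singleton.
have [W [W0 cW] [nW WA]] := absolutely_convex_nbhs0 xA0.
exists (direct_sum_coord i @^-1` W); last by move=> v /WA.
split; first by split=> [|a b y z ab Wy Wz]; [exact: W0|exact: cW].
move=> j; have : (fun e => direct_sum_coord i (direct_sum_inj j e)) @ (0 : E j) --> (0 : E i).
  rewrite -[X in _ --> X](linear0 (prod_coord i \o @prod_inj _ _ E j)).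
  apply: (@continuous_comp _ _ _ (@prod_inj _ _ E j) (prod_coord i)).
    exact: prod_inj_continuous.
  exact: prod_proj_continuous.
by move=> /(_ _ nW).
Qed.

Definition coord_dual (idx : nat -> I) (chi : forall n, topdual (E (idx n))) n :=
  dual_comp (@direct_sum_coord_continuous (idx n)) (chi n).

Lemma coord_dual_inj idx (chi : forall n, topdual (E (idx n))) n j (e : E j) :
  coord_dual chi n (direct_sum_inj j e) = chi n (prod_inj e (idx n)).
Proof. by []. Qed.

(** The absolutely convex set where all the functionals are at most [e] meets
    each summand in a neighborhood, because at most one of the functionals is
    nonzero on that summand. *)
Lemma coord_dual_equicontinuous idx (chi : forall n, topdual (E (idx n))) :
  injective idx -> dual_equicontinuous (coord_dual chi).
Proof.
move=> idx_inj; apply: linear_near0_equicontinuous => e e0.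
exists [set v | forall n, modulus (coord_dual chi n v) <= e]; last first.
  by move=> v Vv; rewrite add0r.
split.
  split=> [n|a b x y]; first by rewrite linear0 modulus0 ltW.
  rewrite !normr_modulus -rmorphD -[1](rmorph1 (of_real k)) ler_of_real => ab Vx Vy n.
  have scaleE c z : modulus (coord_dual chi n (c *: z)) =
      modulus c * modulus (coord_dual chi n z) by rewrite linearZ -modulusM.
  rewrite linearD (le_trans (ler_modulusD _ _)) // !scaleE.
  rewrite (@le_trans _ _ (modulus a * e + modulus b * e)) //.
    by rewrite lerD // ler_wpM2l // modulus_ge0.
  by rewrite -mulrDl -[leRHS]mul1r ler_wpM2r // ltW.
move=> j; have [[m mj]|nj] := pselect (exists m, idx m = j); last first.
  apply: filterE => x n; rewrite coord_dual_inj prod_inj_out.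
    by rewrite linear0 modulus0 ltW.
  by move=> jn; apply: nj; exists n.
have cvg0 : dual_comp (@direct_sum_inj_continuous _ _ E j) (coord_dual chi m) @ (0 : E j)
    --> (0 : K^o).
  rewrite -(linear0 (dual_comp (@direct_sum_inj_continuous _ _ E j) (coord_dual chi m))).
  exact: dual_continuous.
have small : \forall x \near (0 : E j), modulus (coord_dual chi m (direct_sum_inj j x)) < e.
  exact: cvg0 (near0_modulus k e0).
apply: filterS small => x xe n.
have [->|nm] := eqVneq n m; first exact: ltW.
rewrite coord_dual_inj prod_inj_out; first by rewrite linear0 modulus0 ltW.
by rewrite -mj => /idx_inj mn; rewrite mn eqxx in nm.
Qed.

(** At each point all but finitely many terms vanish. *)
Lemma coord_dual_summable p idx (chi : forall n, topdual (E (idx n))) :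
  (1 <= p)%E -> injective idx -> weak_star_summable p (coord_dual chi).
Proof.
move=> p1 idx_inj x.
have fx : finite_set (idx @^-1` supp x).
  by apply: finite_preimage (finite_supp x) => m n _ _; exact: idx_inj.
have [N xN] := finite_nat_bounded fx.
apply: (@lp_c0_finite _ _ _ N) => // n; first exact: modulus_ge0.
move=> Nn; rewrite /= /direct_sum_coord (_ : direct_sum_val x (idx n) = 0).
  by rewrite linear0 modulus0.
by apply/eqP; apply: contraTT Nn => xn; rewrite -ltnNge; exact: xN.
Qed.

Lemma limited_support b p q (A : set S) : (forall i, hausdorff_space (E i)) ->
  (1 <= p)%E -> (1 <= q)%E -> limited_for b p q A -> finite_set (set_supp A).
Proof.
move=> hE p1 q1 [_ lA]; apply: contrapT => /infinite_injection[idx [idx_inj Aidx]].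
have /choice[x xP] n : exists x, A x /\ direct_sum_coord (idx n) x != 0.
  by have [x Ax xn] := Aidx n; exists x.
have chiP n : {chi : topdual (E (idx n)) | chi (direct_sum_coord (idx n) (x n)) = 1}.
  by apply: cid; apply: hausdorff_separation => //; exact: (xP n).2.
pose chi n := sval (chiP n).
have := lp_c0_lt1 q1 _ (lA (coord_dual chi) _ (coord_dual_summable _ _ _)).
move=> /(_ (fun n => dual_seminorm_ge0 _ _)) [|||N _ /(_ N (leqnn N))] //=.
  by move=> _; exact: coord_dual_equicontinuous.
apply/negP; rewrite -leNgt.
have <- : (modulus (coord_dual chi N (x N)))%:E = 1%E.
  by rewrite /= (svalP (chiP N)) modulus1.
by apply: modulus_le_dual_seminorm; exact: (xP N).1.
Qed.

Lemma limited_direct_sum b p q (A : set S) : inhabited I ->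
  (forall i, hausdorff_space (E i)) -> (1 <= p)%E -> (1 <= q)%E ->
  limited_for b p q A <->
  (forall i, limited_for b p q (direct_sum_coord i @` A)) /\
  finite_set (set_supp A).
Proof.
move=> [i0] hE p1 q1; split=> [lA|[lA fA]].
  split=> [i|]; last exact: limited_support lA.
  apply: (limited_image (f := @direct_sum_coord _ _ E i)) lA.
  exact: direct_sum_coord_continuous.
have [_ [x0 Ax0 _]] := (lA i0).1.
split=> [|chi eq cs]; first by exists x0.
have /(@finite_seqP {classic I})[s sE] := fA.
apply: (@limited_decomposition R k b p q S {classic I} (undup s) E
  (fun i => direct_sum_coord i) (fun i => @direct_sum_inj _ _ E i)) => //.
  exact: direct_sum_inj_continuous.
move=> n x Ax; rewrite -linear_sum; congr (chi n _).
apply: direct_sum_decomposition; first exact: undup_uniq.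
move=> i xi; rewrite /= mem_undup.
have : [set` s] i by rewrite -sE; exists x.
by [].
Qed.

End DirectSumDual.

(** * Products and direct sums *)

Theorem proposition3p3 (R : realType) (k : scalar_kind) (p q : \bar R)
  (hp : (1 <= p)%E) (hpq : (p <= q)%E)
  (I : Type) (hI : inhabited I) (E : I -> tvsType (scalars R k))
  (hE : forall i, hausdorff_space (E i)) :
  (forall A : set (prod_topology E),
     (limited p q A <-> forall i, limited p q (prod_coord i @` A)) /\
     (E_limited p q A <-> forall i, E_limited p q (prod_coord i @` A))) /\
  (forall A : set (direct_sum E),
     (limited p q A <->
        (forall i, limited p q (direct_sum_coord i @` A)) /\
        finite_set (set_supp A)) /\
     (E_limited p q A <->
        (forall i, E_limited p q (direct_sum_coord i @` A)) /\
        finite_set (set_supp A))).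
Proof.
have hq : (1 <= q)%E := le_trans hp hpq.
have limE (F : tvsType (scalars R k)) : @limited R k F p q = limited_for false p q.
  by apply/funext => A; apply/propext/limitedP.
have E_limE (F : tvsType (scalars R k)) : @E_limited R k F p q = limited_for true p q.
  by apply/funext => A; apply/propext/E_limitedP.
have limI (A : forall i, set (E i)) :
    (forall i, limited p q (A i)) = forall i, limited_for false p q (A i).
  by apply: eq_forall => i; rewrite limE.
have E_limI (A : forall i, set (E i)) :
    (forall i, E_limited p q (A i)) = forall i, limited_for true p q (A i).
  by apply: eq_forall => i; rewrite E_limE.
split=> A; rewrite limI E_limI limE E_limE.
  by split; exact: limited_prod.
by split; exact: limited_direct_sum.
Qed.
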